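(* Let $G$ be a $k$-fixed graph and let $r=|S(G)|$. Then $k\leq 3$ or $k\geq r-1$.
   Context: Graphs are finite, simple, connected, and (standing assumption) have nontrivial automorphism group $\mathrm{Aut}(G)$. For $S\subseteq V(G)$, $\mathrm{stab}(S)=\{g\in \mathrm{Aut}(G): g(v)=v \text{ for all } v\in S\}$; $S$ is a fixing set if $\mathrm{stab}(S)$ is trivial. $\mathrm{fix}(G)$ is the minimum cardinality of a fixing set; $\mathrm{fxd}(G)$ is the minimum $k$ such that every $k$-element subset of $V(G)$ is a fixing set. $G$ is $k$-fixed if $\mathrm{fix}(G)=\mathrm{fxd}(G)=k$. Two vertices $u,v$ are similar if $g(u)=v$ for some $g\in\mathrm{Aut}(G)$; $S(G)$ is the set of vertices of $G$ that are similar to some vertex other than themselves. *)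

(* Defs.v *)
From mathcomp Require Import all_boot all_fingroup.

Set Implicit Arguments.
Unset Strict Implicit.
Unset Printing Implicit Defensive.

Import GroupScope.

Record sgraph := SGraph {
  vertex : finType;
  adj : rel vertex;
  adj_sym : symmetric adj;
  adj_irr : irreflexive adj
}.

Section GraphAutomorphisms.

Variable G : sgraph.
Implicit Types (S : {set vertex G}) (u v : vertex G) (k : nat).

Definition graph_connected : Prop := forall u v, connect (@adj G) u v.

Definition graph_Aut : {set {perm vertex G}} :=
  [set g : {perm vertex G} | [forall u, forall v, adj (g u) (g v) == adj u v]].

Lemma graph_Aut_group_set : group_set graph_Aut.
Proof.
apply/group_setP; split=> [|g h].
  by rewrite inE; apply/forallP=> u; apply/forallP=> v; rewrite !perm1.
rewrite !inE => /forallP gP /forallP hP.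
apply/forallP=> u; apply/forallP=> v; rewrite !permM.
by rewrite (eqP (forallP (hP _) _)) (eqP (forallP (gP _) _)).
Qed.

Canonical graph_Aut_group := Group graph_Aut_group_set.

Definition graph_stab S : {set {perm vertex G}} := 'C_graph_Aut(S | 'P).

Definition fixing_set S : bool := graph_stab S == 1.

Lemma fixing_setT : fixing_set setT.
Proof.
rewrite /fixing_set eqEsubset sub1G andbT; apply/subsetP=> g.
case/setIP=> _ /astabP gP; rewrite inE; apply/eqP/permP=> u.
by rewrite perm1 -[RHS](gP u) ?inE.
Qed.

Lemma exists_fixing_card :
  exists k, [exists S : {set vertex G}, (#|S| == k) && fixing_set S].
Proof.
exists #|[set: vertex G]|; apply/existsP; exists setT.
by rewrite eqxx fixing_setT.
Qed.

Lemma exists_all_fixing_card :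
  exists k, [forall S : {set vertex G}, (#|S| == k) ==> fixing_set S].
Proof.
exists #|vertex G|; apply/forallP=> S; apply/implyP=> /eqP cardS.
suff -> : S = setT by exact: fixing_setT.
by apply/eqP; rewrite eqEcard subsetT cardsT cardS /=.
Qed.

Definition fix_number : nat := ex_minn exists_fixing_card.

Definition fxd_number : nat := ex_minn exists_all_fixing_card.

Definition k_fixed k : Prop := fix_number = k /\ fxd_number = k.

Definition similar u v : bool := [exists g in graph_Aut, g u == v].

Definition nontriv_similar : {set vertex G} :=
  [set u | [exists v, (v != u) && similar u v]].

End GraphAutomorphisms.

(* Main.v *)
Require Import Defs.
From mathcomp Require Import all_boot all_fingroup.

Set Implicit Arguments.
Unset Strict Implicit.
Unset Printing Implicit Defensive.

Import GroupScope.

(** If G is k-fixed, every set of k-1 vertices has a nontrivial stabilizer while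
    every set of k vertices has a trivial one.  Let k >= 2 and let H be the
    stabilizer of a set S of k-2 vertices: nontrivial elements of H fix at most
    one vertex outside S, and every vertex outside S has a nontrivial stabilizer
    in H, so orbit counting shows that H is transitive outside S.  For k >= 3
    this makes adjacency constant on pairs of distinct vertices, so that G is
    complete; then the transposition of two vertices outside a k-set would be a
    nontrivial automorphism fixing that k-set, so k >= |V(G)| - 1. *)

(** Burnside counting: the identity fixes all of [X] and every other element at most one point, so
    [t] orbits satisfy [t * #|H| < #|X| + #|H|]. Point stabilizers have order at least 2, so each
    orbit has at most [#|H| / 2] points and [2 * #|X| <= t * #|H|]. Together these force [t < 2]. *)
Lemma card_orbits_le1 (aT : finGroupType) (T : finType)
    (to : {action aT &-> T}) (H : {group aT}) (X : {set T}) :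
  [acts H, on X | to] ->
  (forall a, a \in H^# -> #|'Fix_(X | to)[a]| <= 1) ->
  (forall x, x \in X -> 'C_H[x | to] != 1) ->
  #|orbit to H @: X| <= 1.
Proof.
move=> actsHX fix_le1 stab_neq1.
set t := #|_|.
have burnside : t * #|H| < #|X| + #|H|.
  rewrite -(Frobenius_Cauchy actsHX) (bigD1 1) //= -addnS.
  apply: leq_add; first by rewrite subset_leq_card // subsetIl.
  rewrite (cardsD1 1 H) group1 add1n ltnS -sum1_card.
  rewrite [X in _ <= X](eq_bigl (fun a => (a \in H) && (a != 1))).
    by apply: leq_sum => a /andP[aH a1]; rewrite fix_le1 // !inE a1.
  by move=> a; rewrite !inE andbC.
have orbits : 2 * #|X| <= t * #|H|.
  rewrite -(acts_sum_card_orbit actsHX) big_distrr /= -sum_nat_const.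
  apply: leq_sum => _ /imsetP[x xX ->].
  rewrite -(card_orbit_stab to H x) mulnC leq_pmul2l ?cardG_gt1 ?stab_neq1 //.
  by rewrite (cardD1 x) orbit_refl.
rewrite leqNgt; apply/negP => t_gt1.
have : 2 * (t * #|H|) < t * #|H| + 2 * #|H|.
  apply: leq_trans (_ : 2 * (#|X| + #|H|) <= _); first by rewrite ltn_pmul2l.
  by rewrite mulnDr leq_add2r.
by rewrite mul2n -addnn ltn_add2l ltn_pmul2r ?cardG_gt0 // ltnNge t_gt1.
Qed.

Section KFixed.

Variables (G : sgraph) (k : nat).
Hypothesis Gk : k_fixed G k.
Implicit Types (S : {set vertex G}) (u v x y : vertex G).

Lemma k_fixed_fixing S : #|S| = k -> fixing_set S.
Proof.
case: Gk => _; rewrite /fxd_number; case: ex_minnP => m /forallP allP _ <- /eqP.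
exact/implyP.
Qed.

Lemma k_fixed_card_fixing S : fixing_set S -> k <= #|S|.
Proof.
case: Gk; rewrite /fix_number; case: ex_minnP => m _ minP <- _ fixS.
by apply: minP; apply/existsP; exists S; rewrite eqxx.
Qed.

Lemma k_fixed_leq_card : k <= #|vertex G|.
Proof. by rewrite -cardsT k_fixed_card_fixing ?fixing_setT. Qed.

Lemma k_fixed_stab_transitive S x y :
  #|S|.+2 = k -> x \notin S -> y \notin S -> exists2 g, g \in graph_stab S & g x = y.
Proof.
move=> cardS xS yS.
have actsS : [acts 'C_(graph_Aut G)(S | 'P), on ~: S | 'P].
  by rewrite astabsC (subset_trans (subsetIr _ _)) ?astab_sub.
have fixP g v : g \in 'C_(graph_Aut G)(S | 'P) -> v \in S -> g v = v.
  by case/setIP=> _ /astabP; apply.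
have orb1 : #|orbit 'P 'C_(graph_Aut G)(S | 'P) @: ~: S| <= 1.
  apply: (card_orbits_le1 actsS) => [g | v].
  (* Two fixed points of [g] outside [S] would enlarge [S] to a set of [k] vertices fixed pointwise
     by [g], forcing [g = 1]. *)
  - case/setD1P=> g1 gS; rewrite leqNgt; apply/negP=> /card_gt1P[u [v []]].
    move=> /setIP[uS gu] /setIP[vS gv] uv; case/negP: g1.
    have /k_fixed_fixing/eqP stab1 : #|u |: (v |: S)| = k.
      move: uS vS; rewrite !inE => uS vS.
      by rewrite -cardS !cardsU1 !inE negb_or uv uS vS.
    suff: g \in graph_stab (u |: (v |: S)) by rewrite stab1 inE.
    rewrite inE; case/setIP: (gS) => -> _; apply/astabP=> w.
    rewrite !inE => /or3P[/eqP->|/eqP->|/(fixP g _ gS)] //; exact/afix1P.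
  (* A trivial stabilizer of [v] would make [v |: S] a fixing set of only [k - 1] vertices. *)
  - rewrite inE => vS; apply/negP=> /eqP stab1.
    have /k_fixed_card_fixing : fixing_set (v |: S).
      by rewrite /fixing_set /graph_stab setUC astabU setIA stab1.
    by rewrite cardsU1 vS -cardS ltnn.
move/card_le1_eqP: orb1 => orb1.
have orb_in w : w \notin S ->
    orbit 'P 'C_(graph_Aut G)(S | 'P) w
      \in orbit 'P 'C_(graph_Aut G)(S | 'P) @: ~: S.
  by move=> wS; rewrite imset_f // inE.
have : y \in orbit 'P 'C_(graph_Aut G)(S | 'P) x.
  by rewrite -(orb1 _ _ (orb_in x xS) (orb_in y yS)) orbit_refl.
by case/imsetP=> g gS ->; exists g.
Qed.

End KFixed.

Lemma exists_subset_card (T : finType) (A : {set T}) m :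
  m <= #|A| -> exists2 B : {set T}, B \subset A & #|B| = m.
Proof.
case/card_geqP=> s [s_uniq s_size sA]; exists [set x in s].
  by apply/subsetP=> x; rewrite inE => /sA.
by rewrite cardsE (card_uniqP s_uniq).
Qed.

(** Adding [k - 3] further vertices to [v], away from [x] and [y], gives a set of size [k - 2]. By
    transitivity of its stabilizer, some automorphism fixes [v] and sends [x] to [y]. *)
Lemma k_fixed_adj_const (G : sgraph) (k : nat) (v x y : vertex G) :
  k_fixed G k -> 2 < k -> v != x -> v != y -> adj v x = adj v y.
Proof.
case: k => [|[|[|m]]] // Gk _ vx vy.
(* Now [k] is [m + 3], and at most 3 vertices are excluded ([x] and [y] may coincide), so at least
   [m] remain. *)
have [|S SC cardS] := @exists_subset_card _ (~: [set v; x; y]) m.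
  rewrite cardsCs setCK leq_subRL ?max_card //.
  apply: leq_trans (k_fixed_leq_card Gk).
  rewrite -addn3 addnC leq_add2l (leq_trans (leq_card_setU _ _)) //.
  by rewrite cards1 cards2; case: eqP.
have avoid w : w \in [set v; x; y] -> w \notin S.
  by apply: contraL => /(subsetP SC); rewrite inE.
have [|||g /setIP[gA /astabP gS] <-] := @k_fixed_stab_transitive _ _ Gk (v |: S) x y.
- by rewrite cardsU1 avoid ?cardS // !inE eqxx.
- by rewrite !inE eq_sym negb_or vx avoid // !inE eqxx orbT.
- by rewrite !inE eq_sym negb_or vy avoid // !inE eqxx orbT.
have gv : g v = v by apply: gS; rewrite setU11.
by move: gA; rewrite inE => /forallP/(_ v)/forallP/(_ x)/eqP; rewrite gv.
Qed.

Lemma k_fixed_complete (G : sgraph) (k : nat) (u v : vertex G) :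
  graph_connected G -> k_fixed G k -> 2 < k -> adj u v = (u != v).
Proof.
move=> Gconn Gk k_gt2; have [->|uv] := eqVneq u v; first exact: adj_irr.
(* The first step [w] of a path from [u] to [v] is a neighbour of [u], hence so is every vertex
   other than [u]. *)
have /connectP[[|w p] /= up vE] := Gconn u v; first by rewrite vE eqxx in uv.
case/andP: up => uw _; rewrite (k_fixed_adj_const Gk k_gt2 uv (y := w)) //.
by apply: contraTneq uw => ->; rewrite adj_irr.
Qed.

Theorem theorem8 (G : sgraph) (k r : nat) :
  graph_connected G ->
  graph_Aut G != 1%g ->
  k_fixed G k ->
  r = #|nontriv_similar G| ->
  (k <= 3 \/ k >= r - 1)%N.
Proof.
move=> Gconn _ Gk ->; case: (leqP k 3) => [|k_gt3]; [by left | right].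
(* This suffices because [r] is at most the number of vertices. *)
suff Gle : #|vertex G| <= k.+1.
  by rewrite leq_subLR add1n (leq_trans (max_card _)).
rewrite leqNgt; apply/negP => Ggt.
have [|S _ cardS] := @exists_subset_card _ [set: vertex G] k.
  by rewrite cardsT (k_fixed_leq_card Gk).
have /card_gt1P[a [b [aS bS ab]]] : 1 < #|~: S|.
  by rewrite cardsCs setCK cardS leq_subRL ?(k_fixed_leq_card Gk) // addn2.
(* In a complete graph every permutation is an automorphism, and this one moves no vertex of the
   fixing set [S]. *)
have : tperm a b \in graph_stab S.
  rewrite inE; apply/andP; split.
    rewrite inE; apply/forallP=> u; apply/forallP=> v.
    by rewrite !(k_fixed_complete _ _ Gconn Gk) ?(ltnW k_gt3) // (inj_eq perm_inj).
  apply/astabP=> w wS; rewrite /= apermE tpermD //.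
    by apply: contraTneq aS => ->; rewrite inE negbK.
  by apply: contraTneq bS => ->; rewrite inE negbK.
rewrite (eqP (k_fixed_fixing Gk cardS)) inE => /eqP/permP/(_ a).
by rewrite tpermL perm1 => ba; rewrite ba eqxx in ab.
Qed.
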